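(* Let $q$ be an indeterminate and for every integer $k\ge 0$ let \[ c_q(k)=\frac{(q^2;q^4)_k\, (-q;q^2)_k^2}{(q^4;q^4)_k\, (-q^4;q^4)_k^2}\, [6k+1]\, q^{k^2}, \] and \[ a_q(k)=\sum_{j=0}^{k} c_q(j)\, c_q(k-j). \] Then for every positive odd integer $n$, \[ \sum_{k=0}^{n-1} a_q(k)\equiv 0 \pmod{[n]}. \]
   Context: The $q$-shifted factorial is $(a;q)_0=1$ and $(a;q)_n=\prod_{i=0}^{n-1}(1-aq^i)$ for $n\ge1$. The $q$-integer is $[n]=[n]_q=\frac{1-q^n}{1-q}=1+q+\cdots+q^{n-1}$. For polynomials $A_1(q),A_2(q),P(q)\in\mathbb{Z}[q]$, the congruence $\frac{A_1(q)}{A_2(q)}\equiv 0 \pmod{P(q)}$ means that $P(q)$ divides $A_1(q)$ and $\gcd(P(q),A_2(q))=1$; for rational functions $A(q),B(q)\in\mathbb{Z}(q)$, $A(q)\equiv B(q)\pmod{P(q)}$ means $A(q)-B(q)\equiv 0\pmod{P(q)}$. *)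

(* Defs.v *)
From HB Require Import structures.
From mathcomp Require Import all_boot all_order all_algebra.

Set Implicit Arguments.
Unset Strict Implicit.
Unset Printing Implicit Defensive.

Import GRing.Theory.
Local Open Scope ring_scope.

(* (a; q)_n *)
Definition qpoch (R : comNzRingType) (a q : R) (n : nat) : R :=
  \prod_(i < n) (1 - a * q ^+ i).

(* [n]_q in its division-free form, so that it makes sense both in Z[q] (as a
   modulus) and in Z(q). *)
Definition qint (R : comNzRingType) (q : R) (n : nat) : R :=
  \sum_(i < n) q ^+ i.

(* Z(q), as the field of fractions of Z[q]. *)
Notation Zq := {fraction {poly int}}.

Definition toZq : {poly int} -> Zq := @FracField.tofrac {poly int}.

(* The indeterminate q of Z(q). *)
Definition qvar : Zq := toZq 'X.

(* Divisibility in the ring Z[q].  The library's [%|] on {poly int} is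
   pseudo-divisibility, i.e. divisibility up to a nonzero integer factor,
   which is weaker. *)
Definition dvdZq (P A : {poly int}) : Prop := exists B : {poly int}, A = B * P.

(* gcd(P, A) = 1 in the UFD Z[q].  The library's [coprimep] on {poly int} only
   expresses coprimality over Q. *)
Definition coprimeZq (P A : {poly int}) : Prop :=
  forall D : {poly int}, dvdZq D P -> dvdZq D A -> D \is a GRing.unit.

(* A rational function has many representations A1 / A2; one of them with P | A1
   and gcd(P, A2) = 1 is required.  As Z[q] is a UFD, such a representation exists
   iff the reduced one qualifies. *)
Definition qcongr0 (r : Zq) (P : {poly int}) : Prop :=
  exists A1 A2 : {poly int},
    [/\ A2 != 0, r = toZq A1 / toZq A2, dvdZq P A1 & coprimeZq P A2].

Definition qcongr (A B : Zq) (P : {poly int}) : Prop := qcongr0 (A - B) P.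

Definition c_q (k : nat) : Zq :=
  let q := qvar in
  (qpoch (q ^+ 2) (q ^+ 4) k * qpoch (- q) (q ^+ 2) k ^+ 2)
    / (qpoch (q ^+ 4) (q ^+ 4) k * qpoch (- q ^+ 4) (q ^+ 4) k ^+ 2)
  * qint q (6 * k + 1) * q ^+ (k ^ 2).

Definition a_q (k : nat) : Zq := \sum_(j < k.+1) c_q j * c_q (k - j).

(* Main.v *)
Require Import Defs.
From HB Require Import structures.
From mathcomp Require Import all_boot all_order all_algebra all_field.
From mathcomp Require Import ring zify.

Set Implicit Arguments.
Unset Strict Implicit.
Unset Printing Implicit Defensive.

Import GRing.Theory Num.Theory.
Local Open Scope ring_scope.

(* Write c_q(k) = r_k [6k+1].  Cancelling the factors 1 - q^(4i) against a
   Gaussian binomial coefficient leaves only factors 1 + q^j in the denominator,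
   so c_q(k) can be evaluated at every n-th root of unity z, n odd.  As [n] is
   monic with simple roots, it suffices that the convolution sum vanishes at each
   such z != 1.  If z has order N, then c_z(lN + s) = r_(lN) c_z(s) for s < N, and
   c_z(s) = 0 for N/2 < s < N, so that everything reduces to
   c_z(0) + ... + c_z(N - 1) = 0.  This is the case a = z, b = -z, p = z^2,
   M = (N - 1)/2 of a terminating quadratic summation of Gasper and Rahman, whose
   right-hand side contains the factor 1 - a p^M = 1 - z^N.  The summation is
   proved by the Wilf-Zeilberger method for generic a and then specialized. *)

(** * Elementary properties of q-shifted factorials *)

Lemma qpochS (R : comNzRingType) (a q : R) k :
  qpoch a q k.+1 = qpoch a q k * (1 - a * q ^+ k).
Proof. by rewrite /qpoch big_ord_recr. Qed.

Lemma qpoch0 (R : comNzRingType) (a q : R) : qpoch a q 0 = 1.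
Proof. by rewrite /qpoch big_ord0. Qed.

Lemma qpoch_neq0 (F : fieldType) (a q : F) k :
  (forall i, (i < k)%N -> a * q ^+ i != 1) -> qpoch a q k != 0.
Proof.
by move=> h; apply/prodf_neq0 => i _; rewrite subr_eq0 eq_sym h.
Qed.

Lemma qpoch_eq0 (F : fieldType) (a q : F) i k :
  (i < k)%N -> a * q ^+ i = 1 -> qpoch a q k = 0.
Proof.
move=> ik h; apply/eqP; rewrite prodf_seq_eq0; apply/hasP.
by exists (Ordinal ik); rewrite ?mem_index_enum //= h subrr.
Qed.

Lemma qpoch_shift (R : comNzRingType) (a q : R) k :
  qpoch a q k * (1 - a * q ^+ k) = (1 - a) * qpoch (a * q) q k.
Proof.
rewrite -qpochS /qpoch big_ord_recl /= expr0 mulr1; congr (_ * _).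
by apply: eq_bigr => i _; rewrite exprS mulrA.
Qed.

(** * A terminating quadratic summation by the Wilf-Zeilberger method *)

Section Quadratic.
Variables (F : fieldType) (a b p : F).

Definition qweight (d : F) (k : nat) : F :=
  qpoch a p k * qpoch b p k * qpoch (p / b) p k * qpoch d (p ^+ 2) k
  / (qpoch (p ^+ 2) (p ^+ 2) k * qpoch (a * p ^+ 2 / b) (p ^+ 2) k
     * qpoch (a * b * p) (p ^+ 2) k * qpoch (a * p / d) p k)
  * (a / d) ^+ k * p ^+ 'C(k.+1, 2).

(** The customary divisor 1 - a is left out, which is why the numerator in [quadratic_sum] is (a;
    p)_(2M+1) and not (ap; p)_(2M). *)
Definition qterm (d : F) (k : nat) : F := (1 - a * p ^+ (3 * k)) * qweight d k.

(** For k > 0 the factors 1 - p^(2k), 1 - a p^(2k)/b, 1 - a b p^(2k-1) and 1 - a p^k/e are the last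
    ones of the four products in the denominator of [qweight e k], so they cancel there. The first
    makes the certificate vanish at k = 0. *)
Definition qcert (e : F) (k : nat) : F :=
  qweight e k / (1 - e) * (1 - p ^+ k ^+ 2) * (1 - a * p ^+ k ^+ 2 / b)
  * (1 - a * b * p ^+ k ^+ 2 / p) * (1 - a * p ^+ k / e) / p ^+ k ^+ 2.

Hypotheses (b0 : b != 0) (p0 : p != 0).
Hypothesis ap : forall i, a * p ^+ i != 1.
Hypothesis apb : forall i, a * p ^+ i != b.
Hypothesis abp : forall i, a * b * p ^+ i != 1.

Lemma qweightS (e : F) k :
  qweight e k.+1 = qweight e k *
   ((1 - a * p ^+ k) * (1 - b * p ^+ k) * (1 - p * p ^+ k / b)
     * (1 - e * p ^+ k ^+ 2)
    / ((1 - p ^+ 2 * p ^+ k ^+ 2) * (1 - a * p ^+ 2 * p ^+ k ^+ 2 / b)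
       * (1 - a * b * p * p ^+ k ^+ 2) * (1 - a * p * p ^+ k / e))
    * (a / e) * p * p ^+ k).
Proof.
rewrite /qweight !qpochS binS bin1 exprD [_ ^+ k.+1]exprS [p ^+ k.+1]exprS.
rewrite [(p ^+ 2) ^+ k]exprAC; set x := p ^+ k.
have -> : p / b * x = p * x / b by rewrite mulrAC.
have -> : a * p / e * x = a * p * x / e by rewrite mulrAC.
have -> : a * p ^+ 2 / b * x ^+ 2 = a * p ^+ 2 * x ^+ 2 / b by rewrite mulrAC.
by rewrite !invfM; ring.
Qed.

(** Replacing [e] by [e * p ^+ 2] moves (e; p^2)_k by one step and (ap/e; p)_k by two. Each step is
    an instance of [qpoch_shift]; the power p^(-2k) comes from (a/d)^k. *)
Lemma qweight_shift (e : F) k : e != 0 -> 1 - e != 0 ->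
  (forall i, a * p ^+ i != e * p) ->
  (1 - a / (e * p)) * (1 - a / e) * qweight (e * p ^+ 2) k
  = qweight e k * (1 - e * p ^+ k ^+ 2) / (1 - e)
    * (1 - a * p ^+ k / (e * p)) * (1 - a * p ^+ k / e) / p ^+ k ^+ 2.
Proof.
move=> e0 e1 ape; rewrite /qweight.
have hd := qpoch_shift e (p ^+ 2) k; rewrite [(p ^+ 2) ^+ k]exprAC in hd.
have h1 := qpoch_shift (a / (e * p)) p k.
have h2 := qpoch_shift (a / e) p k.
have e1E : a / (e * p) * p = a / e by field; rewrite ?e0 ?p0.
have e2E : a / e * p = a * p / e by rewrite mulrAC.
have e3E : a * p / (e * p ^+ 2) = a / (e * p) by field; rewrite ?e0 ?p0.
rewrite e1E in h1; rewrite e2E in h2; rewrite e3E.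
have x0 : p ^+ k != 0 by rewrite expf_neq0.
have -> : a / (e * p ^+ 2) = a / e / p ^+ 2 by rewrite invfM mulrA.
rewrite [(a / e / _) ^+ k]exprMn exprVn [(p ^+ 2) ^+ k]exprAC.
have q1 : qpoch (a / (e * p)) p k != 0.
  apply: qpoch_neq0 => i _; apply: contraNneq (ape i) => h.
  by apply/eqP; rewrite -[RHS]mul1r -h; field; rewrite ?e0 ?p0.
have q2 : qpoch (a * p / e) p k != 0.
  apply: qpoch_neq0 => i _; apply: contraNneq (ape i.+2) => h.
  by apply/eqP; rewrite -[RHS]mul1r -h !exprS; field; rewrite ?e0 ?p0.
have -> : qpoch (e * p ^+ 2) (p ^+ 2) k
   = qpoch e (p ^+ 2) k * (1 - e * p ^+ k ^+ 2) / (1 - e).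
  by rewrite hd mulrAC mulfV // mul1r.
have -> : (1 - a / (e * p)) * (1 - a / e)
  = qpoch (a / (e * p)) p k / qpoch (a * p / e) p k
    * (1 - a * p ^+ k / (e * p)) * (1 - a * p ^+ k / e).
  have h1' : qpoch (a / (e * p)) p k * (1 - a * p ^+ k / (e * p))
     = (1 - a / (e * p)) * qpoch (a / e) p k by rewrite -h1 (mulrAC a).
  have h2' : qpoch (a / e) p k * (1 - a * p ^+ k / e)
     = (1 - a / e) * qpoch (a * p / e) p k by rewrite -h2 (mulrAC a).
  apply: (mulIf q2); rewrite -[LHS]mulrA -h2' mulrA -h1'.
  by field; rewrite ?q2 ?e0 ?p0.
move: (qpoch (a / (e * p)) p k) (qpoch (a * p / e) p k) q1 q2 => Q Q' q1 q2.
(* [B] is common to both sides and may vanish, so its inverse is generalized before [field]. *)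
set B := qpoch (p ^+ 2) _ _ * _ * _.
rewrite !(invfM B); move: B^-1 => {}B.
by field; rewrite x0 e0 p0 e1 q2 q1.
Qed.

(* The Wilf-Zeilberger relation in the shift [d -> d / p ^+ 2]. *)
Lemma qterm_wz (e : F) k : e != 0 -> 1 - e != 0 ->
  p ^+ (2 * k.+1) != 1 -> (forall i, a * p ^+ i != e * p) ->
  (1 - a / (b * e)) * (1 - a * b / (e * p)) * qterm e k
  - (1 - a / (e * p)) * (1 - a / e) * qterm (e * p ^+ 2) k
  = qcert e k.+1 - qcert e k.
Proof.
move=> e0 e1 pk ape.
have tE : (1 - a / (e * p)) * (1 - a / e) * qterm (e * p ^+ 2) k
  = (1 - a * p ^+ (3 * k)) * qweight e k * (1 - e * p ^+ k ^+ 2) / (1 - e)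
  * (1 - a * p ^+ k / (e * p)) * (1 - a * p ^+ k / e) / p ^+ k ^+ 2.
  by rewrite /qterm mulrCA qweight_shift // !mulrA.
rewrite tE /qcert qweightS /qterm [(3 * k)%N]mulnC exprM [p ^+ k.+1]exprS.
set w := qweight e k.
have x0 : p ^+ k != 0 by rewrite expf_neq0.
have h1 : 1 - p ^+ 2 * p ^+ k ^+ 2 != 0.
  by rewrite subr_eq0 eq_sym -exprMn -exprS -exprM mulnC.
have h2 : b - a * p ^+ 2 * p ^+ k ^+ 2 != 0.
  by rewrite subr_eq0 eq_sym -mulrA -exprMn -exprS -exprM apb.
have h3 : 1 - a * b * p * p ^+ k ^+ 2 != 0.
  by rewrite subr_eq0 eq_sym -mulrA -exprM -exprS abp.
have h4 : e - a * p * p ^+ k != 0.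
  rewrite subr_eq0 eq_sym -mulrA -exprS.
  by apply: contraNneq (ape k.+2) => <-; rewrite -mulrA -exprSr.
(* What remains is an identity of rational functions in x = p^k, with [w] as a common factor. *)
move: (p ^+ k) x0 h1 h2 h3 h4 => x x0 h1 h2 h3 h4.
by field; rewrite exprMn x0 e0 p0 b0 e1 h4 h3 h2 h1.
Qed.

(** The choice d = p^(-2M) makes the series terminate. Summing the Wilf-Zeilberger relation at e =
    p^(-2(M+1)) yields a first-order recurrence in M, which the right-hand side satisfies as well.
    The range of i reaches M + 1 because the relation at k = M involves the weight at M + 1. *)
Lemma quadratic_sum M : (forall i, (0 < i <= M.+1)%N -> p ^+ (2 * i) != 1) ->
  \sum_(k < M.+1) qterm (p ^- (2 * M)) k
  = qpoch a p (2 * M).+1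
    / (qpoch (a * p ^+ 2 / b) (p ^+ 2) M * qpoch (a * b * p) (p ^+ 2) M).
Proof.
elim: M => [|M IH] pM.
  rewrite big_ord1 /qterm /qweight !muln0 !qpochS !qpoch0 !expr0.
  by rewrite !(mulr1, mul1r, invr1).
have pM' i : (0 < i <= M.+1)%N -> p ^+ (2 * i) != 1.
  by case/andP=> i0 iM; apply: pM; rewrite i0 leqW.
have {}IH := IH pM'.
set e := p ^- (2 * M.+1).
have e0 : e != 0 by rewrite invr_neq0 ?expf_neq0.
have e1 : 1 - e != 0.
  by rewrite subr_eq0 eq_sym invr_eq1 pM //= leqnSn.
have ape i : a * p ^+ i != e * p.
  apply: contraNneq (ap (i + (2 * M).+1)) => h.
  by rewrite exprD mulrA h -mulrA -exprS /e mulnS mulVf // expf_neq0.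
have dE : p ^- (2 * M) = e * p ^+ 2.
  by rewrite /e mulnS exprD; field; rewrite ?p0 ?expf_neq0.
have vanish N K : (N < K)%N -> qpoch (p ^- (2 * N)) (p ^+ 2) K = 0.
  move=> NK; apply: (qpoch_eq0 NK).
  by rewrite -exprM mulVf // expf_neq0.
(* The lower end vanishes through 1 - p^0, the upper one because [qweight e] is zero at M + 2. *)
have tele : \sum_(k < M.+2) (qcert e k.+1 - qcert e k) = 0.
  rewrite -(big_mkord xpredT (fun k => qcert e k.+1 - qcert e k)).
  rewrite telescope_sumr // /qcert expr0 expr1n subrr mulr0 !mul0r subr0.
  by rewrite /qweight vanish // mulr0 !mul0r.
(* This zero term extends the sum for M to the range of the sum for M + 1. *)
have last0 : qterm (p ^- (2 * M)) M.+1 = 0.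
  by rewrite /qterm /qweight vanish // mulr0 !mul0r mulr0.
have rec : (1 - a / (b * e)) * (1 - a * b / (e * p))
  * (\sum_(k < M.+2) qterm e k)
  = (1 - a / (e * p)) * (1 - a / e) * (\sum_(k < M.+1) qterm (p ^- (2 * M)) k).
  have -> : \sum_(k < M.+1) qterm (p ^- (2 * M)) k
    = \sum_(k < M.+2) qterm (p ^- (2 * M)) k.
    by rewrite [RHS]big_ord_recr /= last0 addr0.
  apply/eqP; rewrite -subr_eq0 !mulr_sumr -sumrB -[X in _ == X]tele; apply/eqP.
  apply: eq_bigr => k _; rewrite dE qterm_wz //.
  by apply: pM; have := ltn_ord k; lia.
(* From M to M + 1 the two denominators gain the factors in [f1] and [f2], and the numerator gains
   those in [f3] and [f4]. *)
have einv : e^-1 = p ^+ 2 * p ^+ (2 * M) by rewrite /e invrK mulnS exprD.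
have f1 : (1 - a / (b * e)) = 1 - a * p ^+ 2 / b * (p ^+ 2) ^+ M.
  by rewrite invfM einv -exprM; field; rewrite b0.
have f2 : (1 - a * b / (e * p)) = 1 - a * b * p * (p ^+ 2) ^+ M.
  by rewrite invfM einv -exprM; field; rewrite p0.
have f3 : (1 - a / (e * p)) = 1 - a * p ^+ (2 * M).+1.
  by rewrite invfM einv [p ^+ (2 * M).+1]exprS; field; rewrite p0.
have f4 : (1 - a / e) = 1 - a * p ^+ (2 * M).+2.
  by rewrite einv -exprD.
have s1 : 1 - a * p ^+ 2 / b * (p ^+ 2) ^+ M != 0.
  rewrite subr_eq0 eq_sym; apply: contraNneq (apb (2 * M.+1)) => h.
  by rewrite mulnS exprD exprM -[b]mul1r -h; apply/eqP; field; rewrite b0.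
have s2 : 1 - a * b * p * (p ^+ 2) ^+ M != 0.
  by rewrite subr_eq0 eq_sym -exprM -mulrA -exprS abp.
rewrite IH f1 f2 f3 f4 in rec.
rewrite mulnS add2n [qpoch _ _ _.+3]qpochS [qpoch _ _ _.+2]qpochS.
rewrite ![qpoch _ _ M.+1]qpochS; apply: (mulfI (mulf_neq0 s1 s2)); rewrite rec.
set A := qpoch (a * p ^+ 2 / b) _ M; set B := qpoch (a * b * p) _ M.
have -> : (A * (1 - a * p ^+ 2 / b * p ^+ 2 ^+ M)
   * (B * (1 - a * b * p * p ^+ 2 ^+ M)))^-1
   = (A * B)^-1 * ((1 - a * p ^+ 2 / b * p ^+ 2 ^+ M)
   * (1 - a * b * p * p ^+ 2 ^+ M))^-1 by rewrite mulrACA invfM.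
move: s1 s2; set u := 1 - _; set v := 1 - a * b * p * _ => s1 s2.
move: (A * B)^-1 => D.
by field; rewrite s1 s2.
Qed.

End Quadratic.

(** * Evaluation of fractions at a family of points *)

Section Specialization.
Variables (R : idomainType) (F : fieldType) (I : Type).
Variable (f : I -> {rmorphism R -> F}).
Local Notation "x %:F" := (@FracField.tofrac R x).

(* One fraction [A / B] has to serve all the evaluations [f i] at once, since
   divisibility by [n] is tested at all the roots of unity together. *)
Definition specializes (r : {fraction R}) (v : I -> F) : Prop :=
  exists A B : R, [/\ B != 0, r = A%:F / B%:F,
    forall i, f i B != 0 & forall i, v i = f i A / f i B].

Lemma specializes_eq r v w : v =1 w -> specializes r v -> specializes r w.
Proof.
by move=> vw [A [B [? ? ? h]]]; exists A, B; split=> // i; rewrite -vw.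
Qed.

Lemma specializes_frac A : specializes A%:F (fun i => f i A).
Proof.
exists A, 1; rewrite rmorph1 divr1 oner_neq0; split=> // i.
  by rewrite rmorph1 oner_neq0.
by rewrite rmorph1 divr1.
Qed.

Lemma specializes1 : specializes 1 (fun=> 1).
Proof.
rewrite -(rmorph1 (@FracField.tofrac R)).
by apply: specializes_eq (specializes_frac 1) => i; rewrite rmorph1.
Qed.

Lemma specializesD r s v w : specializes r v -> specializes s w ->
  specializes (r + s) (fun i => v i + w i).
Proof.
move=> [A [B [B0 -> fB vE]]] [A' [B' [B'0 -> fB' wE]]].
exists (A * B' + A' * B), (B * B'); split=> [||i|i].
- by rewrite mulf_neq0.
- by rewrite rmorphD !rmorphM addf_div // ?tofrac_eq0.
- by rewrite rmorphM mulf_neq0.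
- by rewrite vE wE rmorphD !rmorphM addf_div.
Qed.

Lemma specializesM r s v w : specializes r v -> specializes s w ->
  specializes (r * s) (fun i => v i * w i).
Proof.
move=> [A [B [B0 -> fB vE]]] [A' [B' [B'0 -> fB' wE]]].
exists (A * A'), (B * B'); split=> [||i|i].
- by rewrite mulf_neq0.
- by rewrite !rmorphM mulf_div.
- by rewrite rmorphM mulf_neq0.
- by rewrite vE wE !rmorphM mulf_div.
Qed.

Lemma specializesN r v : specializes r v -> specializes (- r) (fun i => - v i).
Proof.
move=> [A [B [B0 -> fB vE]]]; exists (- A), B; split=> // [|i].
  by rewrite rmorphN mulNr.
by rewrite vE rmorphN mulNr.
Qed.

(** The point [i0] shows that the numerator is nonzero, hence admissible as the new denominator. *)
Lemma specializesV r v (i0 : I) : (forall i, v i != 0) -> specializes r v ->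
  specializes r^-1 (fun i => (v i)^-1).
Proof.
move=> v0 [A [B [B0 -> fB vE]]].
have fA i : f i A != 0.
  by apply: contraNneq (v0 i) => A0; rewrite vE A0 mul0r.
exists B, A; split=> // [||i].
- by apply: contraNneq (fA i0) => ->; rewrite rmorph0.
- by rewrite invf_div.
- by rewrite vE invf_div.
Qed.

Lemma specializes_sum n (r : 'I_n -> {fraction R}) (v : I -> 'I_n -> F) :
  (forall k, specializes (r k) (v^~ k)) ->
  specializes (\sum_k r k) (fun i => \sum_k v i k).
Proof.
elim: n r v => [|n IH] r v h.
  rewrite big_ord0 -(rmorph0 (@FracField.tofrac R)).
  by apply: specializes_eq (specializes_frac 0) => i; rewrite big_ord0 rmorph0.
rewrite big_ord_recl; apply: specializes_eq (specializesD (h ord0) _).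
  by move=> i; rewrite [RHS]big_ord_recl.
by apply: (IH _ (fun i k => v i (lift ord0 k))) => k; apply: h.
Qed.

Lemma specializes_prod n (r : 'I_n -> {fraction R}) (v : I -> 'I_n -> F) :
  (forall k, specializes (r k) (v^~ k)) ->
  specializes (\prod_k r k) (fun i => \prod_k v i k).
Proof.
elim: n r v => [|n IH] r v h.
  rewrite big_ord0.
  by apply: specializes_eq specializes1 => i; rewrite big_ord0.
rewrite big_ord_recl; apply: specializes_eq (specializesM (h ord0) _).
  by move=> i; rewrite [RHS]big_ord_recl.
by apply: (IH _ (fun i k => v i (lift ord0 k))) => k; apply: h.
Qed.

Lemma specializesX r v n :
  specializes r v -> specializes (r ^+ n) (fun i => v i ^+ n).
Proof.
move=> rv; elim: n => [|n IH]; first exact: specializes1.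
rewrite exprS; apply: specializes_eq (specializesM rv IH) => i.
by rewrite exprS.
Qed.

Lemma specializes_qpoch a q v w n : specializes a v -> specializes q w ->
  specializes (qpoch a q n) (fun i => qpoch (v i) (w i) n).
Proof.
move=> av qw.
apply: (specializes_prod (v := fun i k => 1 - v i * w i ^+ k)) => k.
apply: specializesD; first exact: specializes1.
by apply/specializesN/specializesM => //; apply: specializesX.
Qed.

(** Applied to the difference of two sides, this transfers an identity between fractions to every
    point. *)
Lemma specializes0 v i : specializes 0 v -> v i = 0.
Proof.
move=> [A [B [B0 /esym/eqP + fB ->]]].
rewrite mulf_eq0 invr_eq0 !tofrac_eq0 (negPf B0) orbF => /eqP ->.
by rewrite rmorph0 mul0r.
Qed.

End Specialization.

(** * The summation at roots of unity of odd order *)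

(** At a primitive N-th root of unity the denominator is zero as soon as k >= N, and the quotient is
    then the default value 0; only k < N is meaningful there. *)
Definition qratio (F : fieldType) (q : F) (k : nat) : F :=
  (qpoch (q ^+ 2) (q ^+ 4) k * qpoch (- q) (q ^+ 2) k ^+ 2)
    / (qpoch (q ^+ 4) (q ^+ 4) k * qpoch (- q ^+ 4) (q ^+ 4) k ^+ 2)
  * q ^+ (k ^ 2).

(** Raising [- z ^+ i = 1] to the odd power N would give -1 = 1. Hence no factor 1 + z^i
    vanishes. *)
Lemma opp_exp_neq1 (F : fieldType) (z : F) N i :
  -1 != 1 :> F -> odd N -> z ^+ N = 1 -> - z ^+ i != 1.
Proof.
move=> F2 Nodd zN; apply: contraNneq F2 => h.
rewrite -[X in _ == X](expr1n F N) -[X in X ^+ N]h.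
by rewrite exprNn exprAC zN expr1n mulr1 -signr_odd Nodd.
Qed.

Section OddRoot.
Variables (F : fieldType) (z : F) (N : nat).
Hypotheses (F2 : -1 != 1 :> F) (zN : N.-primitive_root z) (Nodd : odd N).
Local Notation M := N./2.

Lemma odd_orderE : N = (2 * M).+1.
Proof. by rewrite -[LHS]odd_double_half Nodd mul2n. Qed.

Lemma prim_root_neq0 : z != 0.
Proof.
apply: contraTneq (oner_neq0 F) => z0.
by rewrite -(prim_expr_order zN) z0 expr0n (gtn_eqF (prim_order_gt0 zN)) eqxx.
Qed.

Lemma prim_expr4_neq1 i : (0 < i < N)%N -> z ^+ (4 * i) != 1.
Proof.
case/andP=> i0 iN; rewrite -(prim_order_dvd zN) Gauss_dvdr.
  by rewrite gtnNdvd.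
by rewrite (@coprime_pexpr 2 N 2) // coprimen2.
Qed.

Lemma qpoch4_prim_neq0 k : (k < N)%N -> qpoch (z ^+ 4) (z ^+ 4) k != 0.
Proof.
move=> kN; apply: qpoch_neq0 => i ik.
by rewrite -exprS -exprM prim_expr4_neq1 //= (leq_ltn_trans ik).
Qed.

Lemma qpochN4_prim_neq0 k : qpoch (- z ^+ 4) (z ^+ 4) k != 0.
Proof.
apply: qpoch_neq0 => i _.
by rewrite mulNr -exprS -exprM (opp_exp_neq1 _ F2 Nodd (prim_expr_order zN)).
Qed.

Lemma qpoch_half_prim_neq0 k : (k <= M)%N -> qpoch z (z ^+ 2) k != 0.
Proof.
move=> kM; apply: qpoch_neq0 => i ik.
rewrite -exprM -exprS -(prim_order_dvd zN) gtnNdvd //.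
by rewrite odd_orderE ltnS ltn_mul2l /= (leq_trans ik).
Qed.

(** The factor of index M in (z^2; z^4)_k is 1 - z^(4M+2) = 1 - z^(2N). *)
Lemma qratio_eq0 k : (M < k < N)%N -> qratio z k = 0.
Proof.
case/andP=> Mk kN; rewrite /qratio (@qpoch_eq0 _ _ _ M k) ?mul0r //.
rewrite -exprM -exprD.
have -> : (2 + 4 * M = N * 2)%N by rewrite [RHS]mulnC {2}odd_orderE mulnS mulnA.
by rewrite exprM (prim_expr_order zN) expr1n.
Qed.

(** Here (a; p)_k and (ap/d; p)_k are both (z; z^2)_k and cancel, being nonzero for k <= M. The
    squares arise from b = p/b = -z and from ap^2/b = abp = -z^4. *)
Lemma qterm_qratio k : (k <= M)%N ->
  qterm z (- z) (z ^+ 2) (z ^+ 2) k = (1 - z ^+ (6 * k + 1)) * qratio z k.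
Proof.
move=> kM; rewrite /qterm /qweight /qratio.
have z0 := prim_root_neq0; have h := qpoch_half_prim_neq0 kM.
have -> : z ^+ 2 / - z = - z by field; rewrite ?oppr_eq0 ?z0.
have -> : z * (z ^+ 2) ^+ 2 / - z = - z ^+ 4 by field; rewrite ?oppr_eq0 ?z0.
have -> : z * - z * z ^+ 2 = - z ^+ 4 by ring.
have -> : z * z ^+ 2 / z ^+ 2 = z by field; rewrite ?oppr_eq0 ?z0.
have -> : z / z ^+ 2 = z^-1 by field; rewrite ?oppr_eq0 ?z0.
have -> : (z ^+ 2) ^+ 2 = z ^+ 4 by ring.
have -> : z * (z ^+ 2) ^+ (3 * k) = z ^+ (6 * k + 1).
  by rewrite -exprM -exprS addn1 mulnA.
have zE : z^-1 ^+ k * (z ^+ 2) ^+ 'C(k.+1, 2) = z ^+ (k ^ 2).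
  have -> : (z ^+ 2) ^+ 'C(k.+1, 2) = z ^+ k * z ^+ (k ^ 2).
    rewrite -exprM -exprD bin2 mul2n; congr (_ ^+ _).
    by rewrite halfK oddM /= andNb subn0 mulSn mulnn.
  by rewrite mulrA -exprMn mulVf // expr1n mul1r.
rewrite -[X in _ * X = _]mulrA zE.
rewrite [qpoch (- z ^+ 4) _ _ ^+ 2]expr2 mulrA.
move: (qpoch z _ k) h (qpoch (z ^+ 4) _ k * _ * _) => Q Q0 D.
by rewrite (invfM D); move: D^-1 => {}D; field.
Qed.

(** At a = z the hypothesis a p^i != 1 of [quadratic_sum] fails for i = M. The summation is
    therefore used with a an indeterminate over F, and both sides are evaluated at z afterwards; the
    failing factor is what makes the right-hand side zero. *)
Lemma qratio_sum : (1 < N)%N ->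
  \sum_(k < N) (1 - z ^+ (6 * k + 1)) * qratio z k = 0.
Proof.
move=> N1; have M0 : (0 < M)%N by move: N1; rewrite {1}odd_orderE; lia.
have z0 := prim_root_neq0.
pose c (x : F) := @FracField.tofrac {poly F} x%:P.
pose a := @FracField.tofrac {poly F} 'X.
pose f (_ : unit) : {rmorphism {poly F} -> F} := horner_eval z.
(* Setting 'X = 0 in an equality would give y = 0. *)
have ac x y i : y != 0 -> a * c x ^+ i != c y.
  move=> y0; rewrite /a /c -rmorphXn -rmorphM /= tofrac_eq -rmorphXn /=.
  apply: contraNneq y0 => /(congr1 (horner_eval 0)).
  by rewrite /horner_eval !hornerE => <-.
have c0 x : x != 0 -> c x != 0 by rewrite tofrac_eq0 polyC_eq0.
have c1 : c 1 = 1 by rewrite /c !rmorph1.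
have [p0 b0] : c (z ^+ 2) != 0 /\ c (- z) != 0.
  by split; apply: c0; rewrite ?oppr_eq0 ?expf_neq0.
have ap i : a * c (z ^+ 2) ^+ i != 1 by rewrite -c1 ac ?oner_neq0.
have apb i : a * c (z ^+ 2) ^+ i != c (- z) by rewrite ac ?oppr_eq0.
have abp i : a * c (- z) * c (z ^+ 2) ^+ i != 1.
  have -> : a * c (- z) * c (z ^+ 2) ^+ i = a * c (- z * (z ^+ 2) ^+ i) ^+ 1.
    by rewrite expr1 /c !(rmorphM, rmorphXn) /= mulrA.
  by rewrite -c1 ac ?oner_neq0.
(* The bound M + 1 < N holds because M > 0. *)
have pM i : (0 < i <= M.+1)%N -> c (z ^+ 2) ^+ (2 * i) != 1.
  move=> /andP[i0 iM].
  rewrite -c1 /c -!rmorphXn /= tofrac_eq (inj_eq (@polyC_inj _)).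
  rewrite -exprM mulnA prim_expr4_neq1 // i0 (leq_ltn_trans iM) //
    [X in (_ < X)%N]odd_orderE.
  by lia.
have spa : specializes f a (fun=> z).
  by apply: specializes_eq (specializes_frac f 'X) => i;
    rewrite /= /horner_eval hornerX.
have spc x : specializes f (c x) (fun=> x).
  by apply: specializes_eq (specializes_frac f x%:P) => i;
    rewrite /= /horner_eval hornerC.
have S := quadratic_sum b0 p0 ap apb abp pM.

have -> : \sum_(k < N) (1 - z ^+ (6 * k + 1)) * qratio z k
  = \sum_(k < M.+1) qterm z (- z) (z ^+ 2) (z ^+ 2) k.
  rewrite -(big_mkord xpredT (fun k => (1 - z ^+ (6 * k + 1)) * qratio z k)).
  rewrite (@big_cat_nat _ _ _ M.+1) //=; last first.
    by rewrite [X in (_ <= X)%N]odd_orderE; lia.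
  rewrite [X in _ + X]big_nat_cond [X in _ + X]big1 => [|k /andP[kM _]].
    rewrite addr0 big_mkord; apply: eq_bigr => k _.
    by rewrite qterm_qratio // -ltnS.
  by rewrite qratio_eq0 ?mulr0.
have d0 : (z ^+ 2) ^+ (2 * M) != 0 by rewrite !expf_neq0.
(* The terminating value of d is z^2, since z^(4M+2) = z^(2N) = 1. *)
have dz : (z ^+ 2) ^- (2 * M) = z ^+ 2.
  apply: (mulfI d0); rewrite mulfV // -exprSr -odd_orderE exprAC.
  by rewrite (prim_expr_order zN) expr1n.
have E4 : (z ^+ 2) ^+ 2 = z ^+ 4 by rewrite -exprM.
have Eb : z * (z ^+ 2) ^+ 2 / - z = - z ^+ 4 by field; rewrite oppr_eq0.
have Eabp : z * - z * z ^+ 2 = - z ^+ 4 by ring.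
have Ed : z * z ^+ 2 / (z ^+ 2) ^- (2 * M) = z by rewrite dz; field.
have spd k : specializes f (c (z ^+ 2) ^- k) (fun=> (z ^+ 2) ^- k).
  apply: (specializesV tt) => [_|]; first by rewrite !expf_neq0.
  exact: specializesX.
have spdiv r x y : y != 0 -> specializes f r (fun=> x) ->
    specializes f (r / c y) (fun=> x / y).
  by move=> y0 rx; apply/(specializesM rx)/(specializesV tt).
have spab : specializes f (a * c (z ^+ 2) ^+ 2 / c (- z))
    (fun=> z * (z ^+ 2) ^+ 2 / - z).
  apply: spdiv; first by rewrite oppr_eq0.
  by apply: specializesM => //; apply: specializesX.
have spabp : specializes f (a * c (- z) * c (z ^+ 2)) (fun=> z * - z * z ^+ 2).
  by do 2![apply: specializesM => //].
have sp2 : specializes f (c (z ^+ 2) ^+ 2) (fun=> (z ^+ 2) ^+ 2).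
  exact: specializesX.
have spad : specializes f (a * c (z ^+ 2) / c (z ^+ 2) ^- (2 * M))
    (fun=> z * z ^+ 2 / (z ^+ 2) ^- (2 * M)).
  apply: specializesM; first exact: specializesM.
  by apply: (specializesV tt) => // _; rewrite invr_neq0.
have sL : specializes f
    (\sum_(k < M.+1) qterm a (c (- z)) (c (z ^+ 2)) (c (z ^+ 2) ^- (2 * M)) k)
    (fun=> \sum_(k < M.+1) qterm z (- z) (z ^+ 2) ((z ^+ 2) ^- (2 * M)) k).
  apply: specializes_sum => k.
  have kM : (k <= M)%N by rewrite -ltnS.
  apply: specializesM.
    apply: specializesD; first exact: specializes1.
    by apply/specializesN/specializesM => //; apply: specializesX.
  apply: specializesM; last exact: specializesX.
  apply: specializesM; last first.
    apply/specializesX/specializesM => //.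
    by apply: (specializesV tt) => // _; rewrite invr_neq0.
  apply: specializesM.
    apply: specializesM; last exact: specializes_qpoch.
    apply: specializesM; last first.
      apply: specializes_qpoch => //; apply: spdiv => //; by rewrite oppr_eq0.
    by apply: specializesM; apply: specializes_qpoch.
  apply: (specializesV tt) => [_|].
    rewrite Eb Eabp Ed E4 !mulf_neq0 ?qpochN4_prim_neq0 //
      ?qpoch_half_prim_neq0 ?qpoch4_prim_neq0 //.
    by rewrite (leq_ltn_trans kM) // [X in (_ < X)%N]odd_orderE; lia.
  do 3![apply: specializesM; last exact: specializes_qpoch].
  exact: specializes_qpoch.
have sR : specializes f (qpoch a (c (z ^+ 2)) (2 * M).+1 /
     (qpoch (a * c (z ^+ 2) ^+ 2 / c (- z)) (c (z ^+ 2) ^+ 2) M *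
      qpoch (a * c (- z) * c (z ^+ 2)) (c (z ^+ 2) ^+ 2) M)) (fun=> 0).
  pose D := qpoch (z * (z ^+ 2) ^+ 2 / - z) ((z ^+ 2) ^+ 2) M
    * qpoch (z * - z * z ^+ 2) ((z ^+ 2) ^+ 2) M.
  apply: (@specializes_eq _ _ _ _ _ (fun=> qpoch z (z ^+ 2) (2 * M).+1 / D)).
    move=> _; rewrite (@qpoch_eq0 _ _ _ M) ?mul0r //; first by lia.
    by rewrite -exprM -exprS -odd_orderE (prim_expr_order zN).
  apply: specializesM; first exact: specializes_qpoch.
  apply: (specializesV tt) => [_|].
    by rewrite /D Eb Eabp E4 mulf_neq0 ?qpochN4_prim_neq0.
  by apply: specializesM; apply: specializes_qpoch.
have := specializesD sL (specializesN sR).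
by rewrite dz S subrr => /(@specializes0 _ _ _ _ _ tt); rewrite subr0.
Qed.
End OddRoot.

(** * Gaussian binomials and the ratio free of vanishing denominators *)

(* [qbin x m k] is the Gaussian binomial [m + k choose k] in base [x]. *)
Fixpoint qbin (R : comNzRingType) (x : R) (m : nat) : nat -> R :=
  match m with
  | 0 => fun=> 1
  | m'.+1 => fix aux k :=
      if k is k'.+1 then aux k' + x ^+ k'.+1 * qbin x m' k'.+1 else 1
  end.

Lemma qbinSS (R : comNzRingType) (x : R) m k :
  qbin x m.+1 k.+1 = qbin x m.+1 k + x ^+ k.+1 * qbin x m k.+1.
Proof. by []. Qed.

Lemma qbinn0 (R : comNzRingType) (x : R) m : qbin x m 0 = 1.
Proof. by case: m. Qed.

(** The two absorption rules are proved together, since the inductive step of each uses the other.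
    They are kept free of division because 1 - x^i may be zero. *)
Lemma qbin_absorb (R : comNzRingType) (x : R) m k :
  (1 - x ^+ k.+1) * qbin x m k.+1 = (1 - x ^+ (m + k).+1) * qbin x m k
  /\ (1 - x ^+ m.+1) * qbin x m.+1 k = (1 - x ^+ (m + k).+1) * qbin x m k.
Proof.
elim: m k => [|m IHm].
  elim=> [|k [_ IH]]; first by rewrite !addn0 /= !mulr1.
  split; rewrite ?add0n ?[qbin x 0 _]/=  // qbinSS mulrDr IH /= !exprS expr0.
  by rewrite add0n; ring.
elim=> [|k [IHA IHB]].
  split; last by rewrite !qbinn0 addn0.
  have [A B] := IHm 0%N; rewrite qbinSS !qbinn0 mulrDr mulrCA A qbinn0.
  by rewrite !addn0 !exprS expr0; ring.
split.
  have [A B] := IHm k.+1; rewrite qbinSS mulrDr mulrCA A.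
  rewrite -B.
  by rewrite addSn addnS !exprS !exprD; ring.
rewrite qbinSS mulrDr IHB -IHA.
by rewrite addSn addnS !exprS !exprD; ring.
Qed.

Lemma qbin_centralS (R : comNzRingType) (x : R) k :
  (1 - x ^+ k.+1) ^+ 2 * qbin x k.+1 k.+1
  = (1 - x ^+ (2 * k).+1) * (1 - x ^+ (2 * k).+2) * qbin x k k.
Proof.
have [A _] := qbin_absorb x k.+1 k; have [_ B] := qbin_absorb x k k.
rewrite expr2 -mulrA A mulrCA B addSn addnn -mul2n.
by rewrite mulrA [(1 - _) * (1 - _)]mulrC.
Qed.

Lemma rmorph_qint (R S : comNzRingType) (f : {rmorphism R -> S}) q k :
  f (qint q k) = qint (f q) k.
Proof. by rewrite rmorph_sum; apply: eq_bigr => i _; rewrite rmorphXn. Qed.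

Lemma specializes_qbin (R : idomainType) (F : fieldType) (I : Type)
    (f : I -> {rmorphism R -> F}) x v m k :
  specializes f x v -> specializes f (qbin x m k) (fun i => qbin (v i) m k).
Proof.
move=> xv; elim: m k => [|m IHm]; first by move=> k; apply: specializes1.
elim=> [|k IHk]; first exact: specializes1.
apply: specializesD => //; apply: specializesM => //.
exact: specializesX.
Qed.

(* [qratio] with the factors [1 - q ^+ (4 * i)] of the denominator cancelled. *)
Definition qratio_red (F : fieldType) (q : F) (k : nat) : F :=
  qbin (q ^+ 2) k k * qpoch (- q) (q ^+ 2) k ^+ 2
    / (qpoch (- q ^+ 2) (q ^+ 2) k ^+ 2 * qpoch (- q ^+ 4) (q ^+ 4) k ^+ 2)
  * q ^+ (k ^ 2).

(** The index enters only through powers of q with exponents linear in k, so the step is N-periodic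
    in k when q^N = 1. *)
Definition qratio_step (F : fieldType) (q : F) (k : nat) : F :=
  (1 - q ^+ (4 * k + 2)) * (1 + q ^+ (2 * k + 1)) ^+ 2
  / ((1 - q ^+ (4 * k + 4)) * (1 + q ^+ (4 * k + 4)) ^+ 2) * q ^+ (2 * k + 1).

Lemma qratioS (F : fieldType) (q : F) k :
  qratio q k.+1 = qratio q k * qratio_step q k.
Proof.
rewrite /qratio /qratio_step !qpochS.
have -> : q ^+ 2 * q ^+ 4 ^+ k = q ^+ (4 * k + 2) by rewrite -exprM addnC exprD.
have -> : q ^+ 4 * q ^+ 4 ^+ k = q ^+ (4 * k + 4) by rewrite -exprM addnC exprD.
have -> : - q ^+ 4 * q ^+ 4 ^+ k = - q ^+ (4 * k + 4).
  by rewrite mulNr -exprM addnC exprD.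
have -> : - q * q ^+ 2 ^+ k = - q ^+ (2 * k + 1).
  by rewrite mulNr -exprM addn1 exprS.
have -> : (k.+1 ^ 2 = k ^ 2 + (2 * k + 1))%N by rewrite -!mulnn; lia.
by rewrite [q ^+ (_ + (2 * k + 1))]exprD !opprK !exprMn !invfM; ring.
Qed.

(** With y = q^(2k+2), the hypothesis 1 - y^2 != 0 makes both 1 - y and 1 + y nonzero, and
    [qbin_centralS] gives the ratio of the binomials. *)
Lemma qratio_redS (F : fieldType) (q : F) k : (forall i, - q ^+ i != 1) ->
  q ^+ (4 * k + 4) != 1 -> qratio_red q k.+1 = qratio_red q k * qratio_step q k.
Proof.
move=> qN qk; rewrite /qratio_red /qratio_step !qpochS.
have E : (q ^+ 2) ^+ k.+1 ^+ 2 = q ^+ (4 * k + 4).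
  by rewrite -!exprM; congr (_ ^+ _); lia.
have -> : - q ^+ 4 * q ^+ 4 ^+ k = - q ^+ (4 * k + 4).
  by rewrite mulNr -exprM addnC exprD.
have -> : - q ^+ 2 * q ^+ 2 ^+ k = - (q ^+ 2) ^+ k.+1 by rewrite mulNr -exprS.
have -> : - q * q ^+ 2 ^+ k = - q ^+ (2 * k + 1).
  by rewrite mulNr -exprM addn1 exprS.
have -> : (k.+1 ^ 2 = k ^ 2 + (2 * k + 1))%N by rewrite -!mulnn; lia.
have C := qbin_centralS (q ^+ 2) k.
have E2 : (q ^+ 2) ^+ (2 * k).+2 = q ^+ (4 * k + 4).
  by rewrite -!exprM; congr (_ ^+ _); lia.
have E1 : (q ^+ 2) ^+ (2 * k).+1 = q ^+ (4 * k + 2).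
  by rewrite -!exprM; congr (_ ^+ _); lia.
rewrite E1 E2 in C; rewrite !opprK.
have q1 : 1 - q ^+ (4 * k + 4) != 0 by rewrite subr_eq0 eq_sym.
have [q2 q3] : 1 - (q ^+ 2) ^+ k.+1 != 0 /\ 1 + (q ^+ 2) ^+ k.+1 != 0.
  by apply/andP; rewrite -negb_or -mulf_eq0 -subr_sqr expr1n E.
rewrite [q ^+ (_ + (2 * k + 1))]exprD.
have -> : qbin (q ^+ 2) k.+1 k.+1 = (1 - q ^+ (4 * k + 2)) *
  (1 - q ^+ (4 * k + 4)) * qbin (q ^+ 2) k k / (1 - (q ^+ 2) ^+ k.+1) ^+ 2.
  by rewrite -C mulrAC mulfV ?mul1r ?expf_neq0.
have q4 : 1 + q ^+ (4 * k + 4) != 0.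
  by rewrite -[q ^+ _]opprK subr_eq0 eq_sym.
have A0 : qpoch (- q ^+ 2) (q ^+ 2) k != 0.
  by apply: qpoch_neq0 => i _; rewrite mulNr -exprS -exprM.
have B0 : qpoch (- q ^+ 4) (q ^+ 4) k != 0.
  by apply: qpoch_neq0 => i _; rewrite mulNr -exprS -exprM.
rewrite -E in q1 q4 *.
move: (q ^+ (k ^ 2)) (q ^+ (4 * k + 2)) (q ^+ (2 * k + 1)) => u v w.
move: ((q ^+ 2) ^+ k.+1) (qbin _ _ _) q1 q2 q3 q4 => y g q1 q2 q3 q4.
move: (qpoch (- q) _ k) (qpoch (- q ^+ 2) _ k) (qpoch (- q ^+ 4) _ k) A0 B0.
move=> P A B A0 B0.
by field; rewrite q1 q2 q3 q4 A0 B0.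
Qed.

(** By periodicity the steps from lN to lN + r are those from 0 to r, and [qratio] starts at 1. *)
Lemma qratio_redE (F : fieldType) (q : F) N l r : (forall i, - q ^+ i != 1) ->
  q ^+ N = 1 -> (forall i, (0 < i <= r)%N -> q ^+ (4 * i) != 1) ->
  qratio_red q (l * N + r) = qratio_red q (l * N) * qratio q r.
Proof.
move=> qN q1; elim: r => [|r IH] qr.
  by rewrite addn0 /qratio !qpoch0 expr0 !(expr1n, mulr1, invr1).
have qlE i j : q ^+ (i * (l * N + r) + j) = q ^+ (i * r + j).
  by rewrite mulnDr -addnA exprD mulnA mulnC exprM q1 expr1n mul1r.
rewrite addnS qratio_redS // ?qlE; last first.
  have -> : (4 * r + 4 = 4 * r.+1)%N by lia.
  by rewrite qr ?leqnn.
rewrite IH => [|i /andP[i0 ir]]; last by rewrite qr ?i0 ?leqW.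
by rewrite qratioS mulrA /qratio_step !qlE.
Qed.

(** Both sides start at 1 and have the same step. The underlying identities are (q^2; q^4)_k (q^4;
    q^4)_k = (q^2; q^2)_(2k) and (q^4; q^4)_k = (q^2; q^2)_k (-q^2; q^2)_k. *)
Lemma qratio_redE0 (F : fieldType) (q : F) r : (forall i, - q ^+ i != 1) ->
  (forall i, (0 < i <= r)%N -> q ^+ (4 * i) != 1) ->
  qratio_red q r = qratio q r.
Proof.
move=> qN; elim: r => [|r IH] qr.
  by rewrite /qratio_red /qratio !qpoch0 qbinn0 !(expr1n, mulr1, invr1).
rewrite qratio_redS // ?qratioS ?IH // => [i /andP[i0 ir]|].
  by rewrite qr ?i0 ?leqW.
by rewrite -mulnSr qr ?leqnn.
Qed.

(** * Vanishing of convolution sums *)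

Lemma conv_sum_antidiag (R : comNzRingType) (e : nat -> R) n :
  \sum_(k < n) \sum_(j < k.+1) e j * e (k - j)%N
  = \sum_(j < n) e j * \sum_(i < n - j) e i.
Proof.
elim: n => [|n IH]; first by rewrite !big_ord0.
rewrite big_ord_recr /= IH [RHS]big_ord_recr big_ord_recr /= subnn subSnn.
rewrite big_ord1 addrA; congr (_ + _); rewrite -big_split /=.
apply: eq_bigr => j _; rewrite subSn; last exact: ltnW.
by rewrite big_ord_recr mulrDr.
Qed.

(** Write j = lN + r. If r > N/2 then e(j) = 0. Otherwise the inner sum has (m - l - 1)N + (N - r)
    terms: full blocks contribute 0, and the last N - r terms cover every nonzero entry of a block,
    so they sum to 0 too. *)
Lemma conv_sum_eq0 (R : comNzRingType) (e C : nat -> R) N m : odd N ->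
  (forall l r, (r < N)%N -> e (l * N + r)%N = C l * e r) ->
  (forall r, (N./2 < r < N)%N -> e r = 0) ->
  \sum_(r < N) e r = 0 ->
  \sum_(k < m * N) \sum_(j < k.+1) e j * e (k - j)%N = 0.
Proof.
move=> Nodd eC e0 eN; rewrite conv_sum_antidiag big1 // => -[j jlt] _ /=.
have N0 : (0 < N)%N by move: jlt; case: (N) => //; rewrite muln0.
(* The case s = N is included because r may be 0. *)
have partial l s : (s <= N)%N ->
    \sum_(i < l * N + s) e i = C l * \sum_(i < s) e i.
  elim: l s => [|l IH] s sN; rewrite big_split_ord /=.
    rewrite mul0n big_ord0 add0r big_distrr /=; apply: eq_bigr => i _.
    by rewrite add0n -(eC 0%N) ?add0n // (leq_trans _ sN).
  rewrite mulSn addnC IH // eN mulr0 add0r big_distrr /=; apply: eq_bigr => i _.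
  by rewrite -mulSnr eC // (leq_trans _ sN).
have jE := divn_eq j N; set l := (j %/ N)%N in jE; set r := (j %% N)%N in jE.
have rN : (r < N)%N by rewrite ltn_mod.
have [rM|rM] := leqP r N./2; last first.
  by rewrite jE eC // e0 ?rM // mulr0 mul0r.
have lm : (l < m)%N by rewrite ltn_divLR.
have -> : (m * N - j = (m - l.+1) * N + (N - r))%N.
  rewrite jE mulnBl mulSn.
  have : (l.+1 * N <= m * N)%N by rewrite leq_mul2r lm orbT.
  by rewrite mulSn; lia.
rewrite partial ?leq_subr //.
suff -> : \sum_(i < N - r) e i = 0 by rewrite !mulr0.
rewrite -[RHS]eN -!(big_mkord xpredT e).
rewrite [RHS](@big_cat_nat _ _ _ (N - r)) ?leq_subr //=.
rewrite [X in _ = _ + X]big_nat_cond [X in _ = _ + X]big1 ?addr0 // => i.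
case/andP=> /andP[ri iN] _; apply: e0; rewrite iN andbT (leq_trans _ ri) //.
by move: rM (odd_double_half N); rewrite Nodd -mul2n; lia.
Qed.

(** * Divisibility by [n] and coprimality to it, tested at roots of unity *)

Definition zeval (z : algC) : {rmorphism {poly int} -> algC} :=
  horner_eval z \o map_poly intr.

Lemma qint_geom (R : comNzRingType) (q : R) n : (1 - q) * qint q n = 1 - q ^+ n.
Proof. by rewrite -[RHS]opprB subrX1 -mulNr opprB. Qed.

Lemma zevalX z : zeval z 'X = z.
Proof. by rewrite /= /horner_eval map_polyX hornerX. Qed.

Lemma zeval_qint z n : zeval z (qint 'X n) = qint z n.
Proof. by rewrite rmorph_qint zevalX. Qed.

Lemma qint_poly (n : nat) : qint ('X : {poly int}) n = \poly_(i < n) 1.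
Proof. by rewrite poly_def; apply: eq_bigr => i _; rewrite scale1r. Qed.

Lemma size_qint n : size (qint ('X : {poly int}) n) = n.
Proof.
case: n => [|n]; first by rewrite /qint big_ord0 size_poly0.
by rewrite qint_poly size_poly_eq ?oner_neq0.
Qed.

Lemma qint_monic n : (0 < n)%N -> qint ('X : {poly int}) n \is monic.
Proof.
case: n => // n _; rewrite qint_poly.
by apply/monicP; rewrite lead_coef_poly ?oner_neq0.
Qed.

(** As [n] is monic, division with remainder stays in Z[q]. The remainder has size less than n and
    vanishes at the n - 1 distinct powers w, ..., w^(n-1) of a primitive root, so it is zero. *)
Lemma dvdZq_qint n (A : {poly int}) : (0 < n)%N ->
  (forall z : algC, z ^+ n = 1 -> z != 1 -> zeval z A = 0) ->
  dvdZq (qint 'X n) A.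
Proof.
move=> n0 Az; have mon := qint_monic n0.
exists (Pdiv.Ring.rdivp A (qint 'X n)).
have E := Pdiv.RingMonic.rdivp_eq mon A.
set r := Pdiv.Ring.rmodp A (qint 'X n) in E.
have rz z : z ^+ n = 1 -> z != 1 -> zeval z r = 0.
  move=> zn z1; have := Az z zn z1; rewrite E rmorphD rmorphM zeval_qint.
  have : (1 - z) * qint z n == 0 by rewrite qint_geom zn subrr.
  rewrite mulf_eq0 subr_eq0 eq_sym (negPf z1) => /eqP ->.
  by rewrite mulr0 add0r.
suff r0 : r = 0 by rewrite [LHS]E r0 addr0.
have [w wn] := C_prim_root_exists n0.
apply/eqP/negPn/negP => r0.
have r0' : map_poly (intr : int -> algC) r != 0.
  by rewrite -size_poly_eq0 (size_map_inj_poly intr_inj) // size_poly_eq0.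
have := max_poly_roots (rs := [seq w ^+ i | i <- iota 1 n.-1]) r0'.
rewrite size_map size_iota (size_map_inj_poly intr_inj) // => /(_ _ _)/wrap[].
- apply/allP => _ /mapP[i + ->]; rewrite mem_iota => /andP[i0 iN].
  apply/eqP/rz; first by rewrite exprAC (prim_expr_order wn) expr1n.
  by rewrite -(prim_order_dvd wn) gtnNdvd //; move: iN; rewrite add1n prednK.
- rewrite map_inj_in_uniq ?iota_uniq // => i j; rewrite !mem_iota.
  rewrite add1n prednK // => /andP[i0 iN] /andP[j0 jN] /eqP.
  by rewrite (eq_prim_root_expr wn) !modn_small // => /eqP.
have := Pdiv.Ring.ltn_rmodpN0 A (monic_neq0 mon).
by rewrite size_qint -/r => rn; rewrite prednK // leqNgt rn.
Qed.

(** A common divisor D has a unit leading coefficient because [n] is monic. Were D not constant, a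
    complex root of it would be a root of both [n] and B. *)
Lemma coprimeZq_qint n (B : {poly int}) : (0 < n)%N ->
  (forall z : algC, z ^+ n = 1 -> z != 1 -> zeval z B != 0) ->
  coprimeZq (qint 'X n) B.
Proof.
move=> n0 Bz D [E hE] [E' hE'].
have DE : lead_coef E * lead_coef D = 1.
  by rewrite -lead_coefM -hE; apply/monicP/qint_monic.
have Du : lead_coef D \is a GRing.unit.
  by apply/unitrPr; exists (lead_coef E); rewrite mulrC.
have [/size1_polyC DC|sD] := leqP (size D) 1.
  by rewrite DC; rewrite DC lead_coefC in Du; rewrite rmorph_unit.
have : size (map_poly (intr : int -> algC) D) != 1%N.
  by rewrite size_map_inj_poly // ?(gtn_eqF sD) //; exact: intr_inj.
case/closed_rootP => z Dz.
have zD : zeval z D = 0 by apply/eqP.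
have q0 : qint z n = 0 by rewrite -zeval_qint hE rmorphM zD mulr0.
have zn : z ^+ n = 1.
  by apply/eqP; rewrite eq_sym -subr_eq0 -qint_geom q0 mulr0.
(* At 1 the value of [n] is n, which is nonzero. *)
have z1 : z != 1.
  apply: contra_eq_neq q0 => ->; rewrite /qint.
  under eq_bigr do rewrite expr1n.
  by rewrite sumr_const card_ord pnatr_eq0 -lt0n.
by have := Bz z zn z1; rewrite hE' rmorphM zD mulr0 eqxx.
Qed.

(** * Values of c_q at roots of unity, and the congruence *)

Lemma oppr1_neq1_algC : -1 != 1 :> algC.
Proof. by rewrite eq_sym -addr_eq0 (pnatr_eq0 _ 2). Qed.

Lemma qvar_opp_neq1 i : - qvar ^+ i != 1.
Proof.
rewrite /qvar /toZq -rmorphXn -rmorphN /= -(rmorph1 (@FracField.tofrac _)).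
rewrite tofrac_eq.
apply: contraNneq oppr1_neq1_algC => /(congr1 (zeval 1)).
by rewrite rmorphN rmorphXn zevalX rmorph1 expr1n => ->.
Qed.

Lemma qvar_exp_neq1 i : (0 < i)%N -> qvar ^+ i != 1.
Proof.
move=> i0; rewrite /qvar /toZq -rmorphXn -(rmorph1 (@FracField.tofrac _)).
rewrite tofrac_eq; apply: contraTneq i0 => /(congr1 (size \o val)) /=.
by rewrite size_polyXn size_poly1 => -[->].
Qed.

Lemma c_qE k : c_q k = qratio_red qvar k * qint qvar (6 * k + 1).
Proof.
have -> : qratio_red qvar k = qratio qvar k.
  apply: qratio_redE0 => [|i /andP[i0 _]]; first exact: qvar_opp_neq1.
  by rewrite qvar_exp_neq1 // muln_gt0.
rewrite /c_q /qratio; exact: mulrAC.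
Qed.

(** The reduced ratio gives the true value for every k, even beyond the order of z. *)
Definition c_at (F : fieldType) (z : F) (k : nat) : F :=
  qratio_red z k * qint z (6 * k + 1).

(** The order N of z divides n, and [conv_sum_eq0] applies with C(l) = r_(lN). Multiplying by 1 - z
    turns [6k+1] into the factor 1 - z^(6k+1) of [qratio_sum]. *)
Lemma c_at_sum (F : fieldType) n (z : F) : -1 != 1 :> F -> odd n ->
  z ^+ n = 1 -> z != 1 ->
  \sum_(k < n) \sum_(j < k.+1) c_at z j * c_at z (k - j) = 0.
Proof.
move=> F2 n_odd zn z1; have n0 : (0 < n)%N by case: (n) n_odd.
have [N zN Nn] := prim_order_exists n0 zn.
have N_odd := dvdn_odd Nn n_odd.
have N1 : (1 < N)%N.
  rewrite ltn_neqAle (prim_order_gt0 zN) eq_sym andbT.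
  apply: contraNneq z1 => N1.
  by rewrite -(prim_expr_order zN) N1.
have zN1 := prim_expr_order zN.
have opp1 i := opp_exp_neq1 i F2 N_odd zN1.
have exp4 r i : (r < N)%N -> (0 < i <= r)%N -> z ^+ (4 * i) != 1.
  move=> rN /andP[i0 ir].
  by rewrite (prim_expr4_neq1 zN) // i0 (leq_ltn_trans ir).
have z1' : 1 - z != 0 by rewrite subr_eq0 eq_sym.
have redE r : (r < N)%N -> qratio_red z r = qratio z r.
  by move=> rN; apply: qratio_redE0 => // i; apply: exp4.
rewrite -(divnK Nn).
apply: (conv_sum_eq0 _ N_odd (C := fun l => qratio_red z (l * N)))
  => [l r rN|r|].
- have qE : qint z (6 * (l * N + r) + 1) = qint z (6 * r + 1).
    apply: (mulfI z1'); rewrite !qint_geom mulnDr -addnA exprD.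
    rewrite mulnA mulnC exprM.
    by rewrite zN1 expr1n mul1r.
  rewrite /c_at qE (qratio_redE l opp1 zN1 (fun i => exp4 r i rN)) (redE r rN).
  exact: esym (mulrA _ _ _).
- by case/andP=> Nr rN; rewrite /c_at redE // (qratio_eq0 zN) ?Nr ?mul0r.
apply: (mulfI z1'); rewrite mulr0 mulr_sumr -[RHS](qratio_sum F2 zN N_odd N1).
apply: eq_bigr => r _; rewrite /c_at redE // mulrCA mulrC; congr (_ * _).
exact: qint_geom.
Qed.

Theorem theorem2 (n : nat) (n_gt0 : (0 < n)%N) (n_odd : odd n) :
  qcongr (\sum_(k < n) a_q k) 0 (qint ('X : {poly int}) n).
Proof.
(* The root 1 is kept in the family: it provides the point [i0] for every n. *)
pose I := {z : algC | z ^+ n == 1}.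
pose f (i : I) := zeval (val i).
have mkI z : z ^+ n = 1 -> {i : I | val i = z}.
  by move=> /eqP zn; exists (exist _ z zn).
have [i0 _] := mkI 1 (expr1n _ n).
have spq : specializes f qvar (fun i => val i).
  by apply: specializes_eq (specializes_frac f 'X) => i; rewrite /f zevalX.
have spc k : specializes f (c_q k) (fun i => c_at (val i) k).
  have opp1 (i : I) j : - val i ^+ j != 1.
    by have /eqP zn := valP i; exact: opp_exp_neq1 oppr1_neq1_algC n_odd zn.
  rewrite c_qE; apply: specializesM; last first.
    by apply: (specializes_sum (v := fun i (j : 'I__) => val i ^+ j)) => j;
      apply: specializesX.
  have spX a : specializes f (qvar ^+ a) (fun i => val i ^+ a).
    exact: specializesX.
  have spNX a : specializes f (- qvar ^+ a) (fun i => - val i ^+ a).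
    exact: specializesN.
  apply: specializesM => //; apply: specializesM.
    apply: specializesM; first exact: specializes_qbin.
    by apply/specializesX/specializes_qpoch => //; apply: specializesN.
  apply: (specializesV i0) => [i|].
    by rewrite mulf_neq0 // expf_neq0 // qpoch_neq0 // => j _;
      rewrite mulNr -exprS -exprM.
  by apply: specializesM; apply/specializesX/specializes_qpoch.
have [A [B [B0 sE fB vE]]] : specializes f (\sum_(k < n) a_q k)
    (fun i => \sum_(k < n) \sum_(j < k.+1)
      c_at (val i) j * c_at (val i) (k - j)).
  apply: (specializes_sum
    (v := fun i (k : 'I_n) => \sum_(j < k.+1)
      c_at (val i) j * c_at (val i) (k - j))) => k.
  apply: (specializes_sum
    (v := fun i (j : 'I_k.+1) => c_at (val i) j * c_at (val i) (k - j))) => j.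
  exact: specializesM.
(* At each root z != 1 the sum A(z)/B(z) is 0 and B(z) is not, so A(z) = 0. *)
exists A, B; split=> //; first by rewrite subr0.
  apply: dvdZq_qint => // z zn z1; have [i iz] := mkI z zn.
  have /esym/eqP := vE i; rewrite iz c_at_sum ?oppr1_neq1_algC //.
  rewrite mulf_eq0 invr_eq0 (negPf (fB i)) orbF.
  by rewrite /f iz => /eqP.
apply: coprimeZq_qint => // z zn z1; have [i iz] := mkI z zn.
by have := fB i; rewrite /f iz.
Qed.
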